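(* Let $K\subset\mathbb{R}$ be a number field of degree $n$ over $\mathbb{Q}$. If $\alpha_1,\dots,\alpha_n$ and $\beta_1,\dots,\beta_n$ are dual bases for the trace form on $K$, then $$J=\sum_{j=1}^n\begin{bmatrix}\alpha_j\\ 0\end{bmatrix}\wedge\begin{bmatrix}0\\ \beta_j\end{bmatrix}\in\mathbb{R}^2\wedge_{\mathbb{Q}}\mathbb{R}^2$$ is algebraically periodic with periodic direction field $K$. Conversely, if $J$ can be written as $J=\sum_{j=1}^n\begin{bmatrix}\alpha_j\\ 0\end{bmatrix}\wedge\begin{bmatrix}0\\ \beta_j\end{bmatrix}$ with $\alpha_j,\beta_j\in K$, and $J$ is algebraically periodic with periodic direction field $K$ and area $1$, then $\alpha_1,\dots,\alpha_n$ and $\beta_1,\dots,\beta_n$ are dual bases for the trace form on $K$.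
   Context: $\mathbb{R}^2$ and $\mathbb{R}$ are viewed as $\mathbb{Q}$-vector spaces. For $J\in\mathbb{R}^2\wedge_{\mathbb{Q}}\mathbb{R}^2$ and $0\neq v\in\mathbb{R}^2$, let $\pi:\mathbb{R}^2\to\mathbb{R}$ be the orthogonal projection with kernel $\mathbb{R}v$, and let $\mathrm{SAF}_v(J)\in\mathbb{R}\wedge_{\mathbb{Q}}\mathbb{R}$ be the image of $J$ under the map induced by $\pi$. The direction $v$ is algebraically periodic for $J$ if $\mathrm{SAF}_v(J)=0$, and $J$ is algebraically periodic if $\mathrm{SAF}_v(J)=0$ in at least three distinct directions. In that case, after a linear change of coordinates so that the directions of slopes $0,1,\infty$ are algebraically periodic, the set of finite slopes of algebraically periodic directions is (for $J\neq0$) a number field contained in $\mathbb{R}$, independent of the choices, called the periodic direction field of $J$. The area of $J=\sum_i v_i\wedge w_i$ is $\sum_i\det(v_i,w_i)\in\mathbb{R}$, so that $\begin{bmatrix}a\\ 0\end{bmatrix}\wedge\begin{bmatrix}0\\ b\end{bmatrix}$ has area $ab$. The trace form on $K$ is $(x,y)\mapsto \mathrm{tr}_{K/\mathbb{Q}}(xy)$. Two bases $\alpha_i$, $\beta_j$ of $K$ over $\mathbb{Q}$ are dual if $\mathrm{tr}_{K/\mathbb{Q}}(\alpha_i\beta_j)=\delta_{ij}$. *)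

(* Defs.v *)
From HB Require Import structures.
From mathcomp Require Import all_boot all_order all_algebra all_field.
From mathcomp Require Import boolp classical_sets reals ring.
From mathcomp.multinomials Require freeg.

Set Implicit Arguments.
Unset Strict Implicit.
Unset Printing Implicit Defensive.

Import Order.TTheory GRing.Theory Num.Theory.
Import freeg.
Local Open Scope ring_scope.

(* The exterior square of an F-module V, as the quotient of the free module on
   V * V by the submodule generated by the bilinearity and alternation
   relations. *)

Section ExteriorSquare.
Context {F : comNzRingType} {V : lmodType F}.

Definition fgen (u v : V) : {freeg (V * V) / F} := Freeg [:: (1, (u, v))].

Inductive ext2_relation : {freeg (V * V) / F} -> Prop :=
| ext2_relation_linl a u v w :
    ext2_relation (fgen (a *: u + v) w - (a *: fgen u w + fgen v w))
| ext2_relation_linr a u v w :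
    ext2_relation (fgen w (a *: u + v) - (a *: fgen w u + fgen w v))
| ext2_relation_alt v : ext2_relation (fgen v v)
| ext2_relation0 : ext2_relation 0
| ext2_relationP a x y :
    ext2_relation x -> ext2_relation y -> ext2_relation (a *: x + y).

Definition ext2_null : {pred {freeg (V * V) / F}} :=
  fun x => `[< ext2_relation x >].

Lemma ext2_nullP x : reflect (ext2_relation x) (x \in ext2_null).
Proof. exact: asboolP. Qed.

Fact ext2_null_zmod : zmod_closed ext2_null.
Proof.
split=> [|x y /ext2_nullP xR /ext2_nullP yR]; apply/ext2_nullP.
  exact: ext2_relation0.
by rewrite addrC -scaleN1r; apply: ext2_relationP.
Qed.

HB.instance Definition _ :=
  GRing.isZmodClosed.Build {freeg (V * V) / F} ext2_null ext2_null_zmod.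

Lemma ext2_nullZ a x : x \in ext2_null -> a *: x \in ext2_null.
Proof.
move=> /ext2_nullP xR; apply/ext2_nullP; rewrite -[a *: x]addr0.
by apply: ext2_relationP => //; exact: ext2_relation0.
Qed.

End ExteriorSquare.

Definition ext2 (F : comNzRingType) (V : lmodType F) : Type :=
  Quotient.quot (@ext2_null F V).

Section Ext2Module.
Context {F : comNzRingType} {V : lmodType F}.
Local Notation E := (ext2 V).
Local Open Scope quotient_scope.

HB.instance Definition _ := GRing.Zmodule.on E.
HB.instance Definition _ := ZmodQuotient.on E.

Definition ext2_scale (a : F) := lift_op1 E ( *:%R a).

Lemma pi_ext2_scale a : {morph \pi_E : x / a *: x >-> ext2_scale a x}.
Proof.
move=> x; unlock ext2_scale; apply/eqP.
rewrite -Quotient.idealrBE -scalerBr; apply: ext2_nullZ.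
by rewrite Quotient.idealrBE reprK.
Qed.

Fact ext2_scaleA a b x : ext2_scale a (ext2_scale b x) = ext2_scale (a * b) x.
Proof. by elim/quotW: x => x; rewrite -!pi_ext2_scale scalerA. Qed.

Fact ext2_scale1 : left_id 1 ext2_scale.
Proof. by elim/quotW=> x; rewrite -pi_ext2_scale scale1r. Qed.

Fact ext2_scaleDr : right_distributive ext2_scale +%R.
Proof.
move=> a; elim/quotW=> x; elim/quotW=> y.
by rewrite -raddfD -!pi_ext2_scale scalerDr raddfD.
Qed.

Fact ext2_scaleDl v : {morph ext2_scale^~ v : a b / a + b}.
Proof.
by elim/quotW: v => x a b; rewrite -!pi_ext2_scale scalerDl raddfD.
Qed.

HB.instance Definition _ := GRing.Zmodule_isLmodule.Build F E
  ext2_scaleA ext2_scale1 ext2_scaleDr ext2_scaleDl.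

Lemma pi_ext2Z a : {morph \pi_E : x / a *: x >-> a *: x}.
Proof. exact: pi_ext2_scale. Qed.

Definition wedge (u v : V) : E := \pi_E (fgen u v).

End Ext2Module.

Section UniversalProperty.
Context {F : comNzRingType} {V W : lmodType F}.

Lemma wedgePl a (u v w : V) : wedge (a *: u + v) w = a *: wedge u w + wedge v w.
Proof.
rewrite /wedge [RHS](_ : _ = \pi_(ext2 V)%qT (a *: fgen u w + fgen v w)).
  by apply/eqP; rewrite -Quotient.idealrBE; apply/ext2_nullP; constructor.
by rewrite raddfD /= pi_ext2Z.
Qed.

Lemma wedgePr a (u v w : V) : wedge w (a *: u + v) = a *: wedge w u + wedge w v.
Proof.
rewrite /wedge [RHS](_ : _ = \pi_(ext2 V)%qT (a *: fgen w u + fgen w v)).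
  by apply/eqP; rewrite -Quotient.idealrBE; apply/ext2_nullP; constructor.
by rewrite raddfD /= pi_ext2Z.
Qed.

Lemma wedgevv (v : V) : wedge v v = 0.
Proof.
rewrite /wedge -[RHS](raddf0 (\pi_(ext2 V)%qT)).
by apply/eqP; rewrite -Quotient.idealrBE subr0; apply/ext2_nullP; constructor.
Qed.

Definition alternating (f : V -> V -> W) : Prop :=
  [/\ forall w, linear (f^~ w), forall w, linear (f w) & forall v, f v v = 0].

Definition ext2_lift (f : V -> V -> W) (x : ext2 V) : W :=
  fglift (fun p : V * V => f p.1 p.2) (repr x).

Lemma fglift_is_linear (K : choiceType) (f : K -> W) : linear (fglift f).
Proof.
have liftD x y : fglift f (x + y) = fglift f x + fglift f y.
  have := lift_is_additive f (x + y) y; rewrite addrK => ->.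
  by rewrite subrK.
have lift0 : fglift f 0 = 0.
  by have := lift_is_additive f 0 0; rewrite !subrr.
move=> a x y; rewrite liftD; congr (_ + _).
elim/freeg_ind_dom0: x => [|k x D _ _ IH]; first by rewrite scaler0 lift0 scaler0.
have aU : a *: Freeg [:: (k, x)] = Freeg [:: (a * k, x)].
  by apply/eqP/freeg_eqP => z; rewrite coeffZ !coeffU mulrA.
by rewrite scalerDr !liftD IH aU !liftU scalerDr scalerA.
Qed.

Section Lift.
Variable (f : V -> V -> W).
Hypothesis f_alt : alternating f.

Let g (p : V * V) := f p.1 p.2.

Let gP : linear (fglift g).
Proof. exact: fglift_is_linear. Qed.

Let g0 : fglift g 0 = 0.
Proof. by have := gP (-1) 0 0; rewrite scaler0 addr0 scaleN1r addNr. Qed.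

Let gB x y : fglift g (x - y) = fglift g x - fglift g y.
Proof. by have := gP (-1) y x; rewrite !scaleN1r ![- _ + _]addrC. Qed.

Let fglift_null x : ext2_relation x -> fglift g x = 0.
Proof.
case: f_alt => fl fr f0.
elim=> [a u v w|a u v w|v||a {}x y _ xE _ yE] //.
- by rewrite gB gP !liftU !scale1r /g /= fl subrr.
- by rewrite gB gP !liftU !scale1r /g /= fr subrr.
- by rewrite liftU scale1r /g /= f0.
- by rewrite gP xE yE scaler0 addr0.
Qed.

Let ext2_lift_pi x : ext2_lift f (\pi_(ext2 V)%qT x) = fglift g x.
Proof.
apply/eqP; rewrite -subr_eq0 -gB; apply/eqP/fglift_null/ext2_nullP.
by rewrite Quotient.idealrBE reprK.
Qed.

Lemma ext2_lift_wedge u v : ext2_lift f (wedge u v) = f u v.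
Proof. by rewrite ext2_lift_pi liftU scale1r. Qed.

Lemma ext2_lift_is_linear : linear (ext2_lift f).
Proof.
move=> a; elim/quotW=> x; elim/quotW=> y.
by rewrite -pi_ext2Z -raddfD !ext2_lift_pi gP.
Qed.

End Lift.

Lemma ext2_span_ind (P : ext2 V -> Prop) :
  P 0 -> (forall a u v x, P x -> P (a *: wedge u v + x)) -> forall x, P x.
Proof.
move=> P0 PS; elim/quotW; elim/freeg_ind_dom0 => [|k [u v] D _ _ IH].
  by rewrite raddf0.
have -> : Freeg [:: (k, (u, v))] = k *: fgen u v.
  by apply/eqP/freeg_eqP => z; rewrite coeffZ !coeffU mul1r.
by rewrite raddfD /= pi_ext2Z; apply: PS.
Qed.

End UniversalProperty.

Section Functoriality.
Context {F : comNzRingType} {V W : lmodType F}.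
Variable (f : {linear V -> W}).

Definition ext2_map : ext2 V -> ext2 W :=
  ext2_lift (fun u v => wedge (f u) (f v)).

Fact ext2_map_alternating : alternating (fun u v => wedge (f u) (f v)).
Proof.
split=> [w a u v|w a u v|v] /=; last exact: wedgevv.
  by rewrite linearP wedgePl.
by rewrite linearP wedgePr.
Qed.

Lemma ext2_map_wedge u v : ext2_map (wedge u v) = wedge (f u) (f v).
Proof. exact: ext2_lift_wedge ext2_map_alternating _ _. Qed.

Fact ext2_map_is_linear : linear ext2_map.
Proof. exact: ext2_lift_is_linear ext2_map_alternating. Qed.

HB.instance Definition _ :=
  GRing.isLinear.Build F (ext2 V) (ext2 W) *:%R ext2_map ext2_map_is_linear.

End Functoriality.

(* Restriction of scalars from R to Q. *)

Definition ratspace (R : numFieldType) (V : lmodType R) : Type := V.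

Section RatSpace.
Context {R : numFieldType} {V : lmodType R}.

HB.instance Definition _ := GRing.Zmodule.on (ratspace V).

Definition ratspace_scale (q : rat) (v : ratspace V) : ratspace V :=
  ratr q *: (v : V).

Fact ratspace_scaleA a b v :
  ratspace_scale a (ratspace_scale b v) = ratspace_scale (a * b) v.
Proof. by rewrite /ratspace_scale scalerA rmorphM. Qed.

Fact ratspace_scale1 : left_id 1 ratspace_scale.
Proof. by move=> v; rewrite /ratspace_scale rmorph1 scale1r. Qed.

Fact ratspace_scaleDr : right_distributive ratspace_scale +%R.
Proof. by move=> a u v; apply: scalerDr. Qed.

Fact ratspace_scaleDl v : {morph ratspace_scale^~ v : a b / a + b}.
Proof. by move=> a b; rewrite /ratspace_scale rmorphD; apply: scalerDl. Qed.

HB.instance Definition _ := GRing.Zmodule_isLmodule.Build rat (ratspace V)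
  ratspace_scaleA ratspace_scale1 ratspace_scaleDr ratspace_scaleDl.

End RatSpace.

Section RatLinear.
Context {R : numFieldType} {V W : lmodType R}.
Variable (f : {linear V -> W}).

Definition ratlin (v : ratspace V) : ratspace W := f v.

Fact ratlin_is_linear : linear ratlin.
Proof. by move=> a u v; apply: linearP. Qed.

HB.instance Definition _ := GRing.isLinear.Build rat (ratspace V) (ratspace W)
  *:%R ratlin ratlin_is_linear.

End RatLinear.

Definition planeQ (R : realType) : lmodType rat := ratspace 'cV[R]_2.
Definition lineQ (R : realType) : lmodType rat := ratspace R^o.

Section AlgebraicPeriodicity.
Context {R : realType}.
Local Notation planeQ := (planeQ R).
Local Notation lineQ := (lineQ R).

Definition vec2 (a b : R) : planeQ := \col_(i < 2) (if i == 0 then a else b).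

Definition det2 (v w : 'cV[R]_2) : R := \det (row_mx v w : 'M_(1 + 1)).

(* The orthogonal projection onto the line orthogonal to v, that line being
   identified with R by the unit vector (- v_2, v_1) / |v|. *)
Definition orthproj (v x : 'cV[R]_2) : R^o :=
  (v 0 0 * x 1 0 - v 1 0 * x 0 0) / Num.sqrt (v 0 0 ^+ 2 + v 1 0 ^+ 2).

Fact orthproj_is_linear v : linear (orthproj v).
Proof.
move=> a x y; rewrite /orthproj !mxE /GRing.scale /=.
by move: (_^-1) => c; ring.
Qed.

HB.instance Definition _ v := GRing.isLinear.Build R 'cV[R]_2 R^o *:%R
  (orthproj v) (orthproj_is_linear v).

Definition SAF (v : 'cV[R]_2) : ext2 planeQ -> ext2 lineQ :=
  ext2_map (ratlin (orthproj v) : {linear planeQ -> lineQ}).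

Fact SAF_is_linear v : linear (SAF v).
Proof. exact: linearP. Qed.

HB.instance Definition _ v := GRing.isLinear.Build rat (ext2 planeQ)
  (ext2 lineQ) *:%R (SAF v) (SAF_is_linear v).

Definition periodic_direction (J : ext2 planeQ) (v : 'cV[R]_2) : Prop :=
  v != 0 /\ SAF v J = 0.

(* Two nonzero vectors span distinct directions when they are not parallel. *)
Definition algebraically_periodic (J : ext2 planeQ) : Prop :=
  exists v1 v2 v3 : 'cV[R]_2,
    [/\ periodic_direction J v1, periodic_direction J v2
      & periodic_direction J v3] /\
    [/\ det2 v1 v2 != 0, det2 v1 v3 != 0 & det2 v2 v3 != 0].

Definition linear_action (g : 'M[R]_2) : ext2 planeQ -> ext2 planeQ :=
  ext2_map (ratlin (mulmx g) : {linear planeQ -> planeQ}).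

Fact linear_action_is_linear g : linear (linear_action g).
Proof. exact: linearP. Qed.

HB.instance Definition _ g := GRing.isLinear.Build rat (ext2 planeQ)
  (ext2 planeQ) *:%R (linear_action g) (linear_action_is_linear g).

(* The finite slope s is the slope of the direction (1, s). *)
Definition periodic_slopes (J : ext2 planeQ) : set R :=
  [set s | periodic_direction J (vec2 1 s)].

(* The directions of slopes 0, 1 and oo are algebraically periodic. *)
Definition normalized (J : ext2 planeQ) : Prop :=
  [/\ periodic_direction J (vec2 1 0), periodic_direction J (vec2 1 1)
    & periodic_direction J (vec2 0 1)].

(* The field is independent of the linear change of coordinates g, so all the
   normalizing g are required to give K; lemma normalized_exists below shows
   that an algebraically periodic J has a normalizing g. *)
Definition is_periodic_direction_field (J : ext2 planeQ) (K : set R) : Prop :=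
  [/\ J != 0, algebraically_periodic J
    & forall g : 'M[R]_2, g \in unitmx -> normalized (linear_action g J) ->
        periodic_slopes (linear_action g J) = K].

Definition area : ext2 planeQ -> R :=
  ext2_lift (det2 : planeQ -> planeQ -> lineQ).

Lemma det2E (v w : 'cV[R]_2) : det2 v w = v 0 0 * w 1 0 - v 1 0 * w 0 0.
Proof.
rewrite /det2 (expand_det_row _ 0) !big_ord_recl big_ord0 addr0.
rewrite /cofactor !det_mx11 /= !mxE /= /bump /= expr0 expr1 mul1r mulN1r.
have -> : fintype.lift 0 0 = 1 :> 'I_2 by apply/val_inj.
have splitE (u : 'I_1 + 'I_1) (i : 'I_(1 + 1)) :
    unsplit u = i :> nat -> split i = u.
  by move=> /val_inj <-; rewrite unsplitK.
rewrite (splitE (inl 0) ord0) // (splitE (inr 0) 1) //.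
rewrite (splitE (inl 0)) //.
by rewrite mulrN [w 0 0 * _]mulrC.
Qed.

Lemma area_wedge (v w : planeQ) : area (wedge v w) = det2 v w.
Proof.
rewrite /area ext2_lift_wedge //; split=> [z a x y|z a x y|x] /=.
- rewrite !det2E !mxE /GRing.scale /= /ratspace_scale.
  by rewrite -[ratr a *: _]/(ratr a * _); move: (ratr a) => c; ring.
- rewrite !det2E !mxE /GRing.scale /= /ratspace_scale.
  by rewrite -[ratr a *: _]/(ratr a * _); move: (ratr a) => c; ring.
- by rewrite det2E mulrC subrr.
Qed.

Lemma SAF_wedge (v : 'cV[R]_2) (x y : planeQ) :
  SAF v (wedge x y) = wedge (orthproj v x : lineQ) (orthproj v y : lineQ).
Proof. exact: ext2_map_wedge. Qed.

Lemma linear_action_wedge (g : 'M[R]_2) (x y : planeQ) :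
  linear_action g (wedge x y) = wedge (g *m x : planeQ) (g *m y : planeQ).
Proof. exact: ext2_map_wedge. Qed.

Lemma area_vec2 (a b : R) : area (wedge (vec2 a 0) (vec2 0 b)) = a * b.
Proof. by rewrite area_wedge det2E !mxE /= mul0r subr0. Qed.

Lemma det2_mulmx (g : 'M[R]_2) (v w : 'cV[R]_2) :
  det2 (g *m v) (g *m w) = \det g * det2 v w.
Proof. by rewrite /det2 -mul_mx_row det_mulmx. Qed.

Lemma orthprojE (v x : 'cV[R]_2) :
  orthproj v x = det2 v x / Num.sqrt (v 0 0 ^+ 2 + v 1 0 ^+ 2).
Proof. by rewrite det2E. Qed.

Lemma norm2_neq0 (v : 'cV[R]_2) :
  v != 0 -> Num.sqrt (v 0 0 ^+ 2 + v 1 0 ^+ 2) != 0.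
Proof.
apply: contraNneq => /eqP; rewrite sqrtr_eq0 => le0.
have : v 0 0 ^+ 2 + v 1 0 ^+ 2 == 0 by rewrite eq_le le0 addr_ge0 ?sqr_ge0.
rewrite paddr_eq0 ?sqr_ge0 // !sqrf_eq0 => /andP[/eqP v0 /eqP v1].
apply/eqP/matrixP => i j; rewrite ord1 mxE.
by case: (unliftP 0 i) => [k|] -> //; rewrite ord1 -[RHS]v1; congr (v _ 0); apply/val_inj.
Qed.

Lemma SAF_linear_action (g : 'M[R]_2) (v w : 'cV[R]_2) (c : R) (J : ext2 planeQ) :
  (forall x, orthproj w (g *m x) = c * orthproj v x) ->
  SAF v J = 0 -> SAF w (linear_action g J) = 0.
Proof.
move=> gvw J0.
pose h : {linear lineQ -> lineQ} := ratlin ( *:%R c : R^o -> R^o).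
suff -> : SAF w (linear_action g J) = ext2_map h (SAF v J).
  by rewrite J0 linear0.
elim/(@ext2_span_ind rat planeQ): J {J0} => [|a x y J IH]; first by rewrite !linear0.
rewrite !linearP /= IH linear_action_wedge !SAF_wedge ext2_map_wedge /=.
by congr (_ *: wedge _ _ + _); apply: gvw.
Qed.

Lemma periodic_direction_action (g : 'M[R]_2) (J : ext2 planeQ) (v : 'cV[R]_2) (c : R) :
  g \in unitmx -> c != 0 -> periodic_direction J v ->
  periodic_direction (linear_action g J) (c *: (g *m v)).
Proof.
move=> gU c0 [v0 Jv]; have gv0 : c *: (g *m v) != 0.
  rewrite scaler_eq0 negb_or c0 /=; apply: contraNneq v0 => gv.
  by rewrite -(mulKmx gU v) gv mulmx0.
split=> //.
pose n (u : 'cV[R]_2) := Num.sqrt (u 0 0 ^+ 2 + u 1 0 ^+ 2).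
apply: (@SAF_linear_action g v _ (c * \det g * n v / n (c *: (g *m v)))) Jv => x.
rewrite !orthprojE -/(n v) -/(n (c *: _)).
have -> : det2 (c *: (g *m v)) (g *m x) = c * (\det g * det2 v x).
  by rewrite -det2_mulmx !det2E !mxE; ring.
by field; rewrite !norm2_neq0.
Qed.

Lemma normalized_exists (J : ext2 planeQ) : algebraically_periodic J ->
  exists2 g : 'M[R]_2, g \in unitmx & normalized (linear_action g J).
Proof.
move=> [v1 [v2 [v3 [[J1 J2 J3] [d12 d13 d23]]]]].
pose a := - (det2 v2 v3 / det2 v1 v2); pose b := det2 v1 v3 / det2 v1 v2.
have a0 : a != 0 by rewrite oppr_eq0 mulf_neq0 ?invr_neq0.
have b0 : b != 0 by rewrite mulf_neq0 ?invr_neq0.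
pose h : 'M[R]_2 := row_mx (a *: v1) (b *: v2) : 'M_(1 + 1).
have hdet : \det h = a * b * det2 v1 v2.
  by rewrite -/(det2 _ _) !det2E !mxE; ring.
have hU : h \in unitmx by rewrite unitmxE hdet unitfE mulf_neq0 // mulf_neq0.
have hE x y : h *m (vec2 x y : 'cV[R]_2) = (x * a) *: v1 + (y * b) *: v2.
  have <- : col_mx (x%:M : 'M_1) (y%:M : 'M_1) = vec2 x y :> 'cV[R]_(1 + 1).
    apply/matrixP => i j; rewrite ord1 !mxE.
    case: splitP => k; rewrite (ord1 k) !mxE eqxx mulr1n => ik; case: eqP => //.
      by case; apply/val_inj.
    by move=> i0; move: ik; rewrite i0.
  have := mul_row_col (a *: v1) (b *: v2) (x%:M : 'M_1) (y%:M : 'M_1).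
  by rewrite !mul_mx_scalar !scalerA.
have v3E : v3 = a *: v1 + b *: v2.
  have d0 : v1 0 0 * v2 1 0 - v1 1 0 * v2 0 0 != 0 by rewrite -det2E.
  apply/matrixP => i j; rewrite ord1 !mxE /a /b !det2E.
  case: (unliftP 0 i) => [k|] ->; last by field.
  have -> : fintype.lift 0 k = 1 :> 'I_2 by rewrite (ord1 k); apply/val_inj.
  by field.
exists (invmx h); first by rewrite unitmx_inv.
have gE x y : (vec2 x y : 'cV[R]_2) = invmx h *m ((x * a) *: v1 + (y * b) *: v2).
  by rewrite -hE mulKmx.
rewrite /normalized !gE !mul0r !mul1r !scale0r addr0 add0r -v3E.
rewrite -!scalemxAr -[_ *m v3]scale1r.
by split; apply: periodic_direction_action; rewrite ?unitmx_inv ?oner_eq0.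
Qed.

End AlgebraicPeriodicity.

Section DualBases.
Context {K : fieldExtType rat}.

(* tr_{K/Q}(x) is the trace of the Q-linear map of multiplication by x; the
   library's galTrace is the field trace only for Galois extensions. *)
Definition field_trace (x : K) : rat :=
  \tr (passmx.mxof (vbasis {:K}) (vbasis {:K}) (amulr x)).

Definition dual_bases (n : nat) (alpha beta : n.-tuple K) : Prop :=
  [/\ basis_of {:K} alpha, basis_of {:K} beta
    & forall i j : 'I_n, field_trace (tnth alpha i * tnth beta j) = (i == j)%:R].

End DualBases.

(* Main.v *)
(** Apart from the slopes 0 and oo, which are always periodic, the slope s is
    periodic for J = sum_j (a_j, 0) ^ (0, b_j) exactly when
    sum_j (s a_j) ^ b_j = 0, i.e. when s a_1 (x) b_1 + ... + s a_n (x) b_n is a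
    symmetric tensor.  Contracting with Q-linear forms of the shape
    (form on K) o (K-linear map R -> K) shows that such an s lies in K unless
    sum_j a_j b_j = 0, and that all of K is periodic only if
    sum_j tr(x a_j) b_j = x sum_j a_j b_j for every x in K.  When the area
    sum_j a_j b_j is 1 this says that (a_j) and (b_j) are dual bases;
    conversely dual bases make the tensor symmetric for every s in K and force
    the area to be 1.  The periodic directions then being the K-rational ones,
    a change of coordinates that normalizes J lies in GL_2(K) up to a real
    factor, hence preserves the set K of slopes. *)

Require Import Defs.
From HB Require Import structures.
From mathcomp Require Import all_boot all_order all_algebra all_field.
From mathcomp Require Import boolp classical_sets reals ring.

Set Implicit Arguments.
Unset Strict Implicit.
Unset Printing Implicit Defensive.

Import Order.TTheory GRing.Theory Num.Theory.
Local Open Scope ring_scope.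
Local Open Scope classical_set_scope.

(** * Separating a vector from a subspace by a linear form *)

Section Separation.
Context {F : fieldType} {V : lmodType F}.

(** Zorn's lemma enlarges [U] to a maximal subspace [W] missing [x]. Maximality makes [W] a
    complement of the line through [x], and [f] reads off the coefficient of [x]. *)
Lemma scalar_separation (U : set V) (x : V) :
    U 0 -> (forall a u v, U u -> U v -> U (a *: u + v)) -> ~ U x ->
  exists f : {scalar V}, f x = 1 /\ forall u, U u -> f u = 0.
Proof.
move=> U0 UP xU.
(* The union with [U] lets the empty chain pass: its union is empty, and [U] alone satisfies the
   condition. *)
pose P (A : set V) := (forall a u v, (A `|` U) u -> (A `|` U) v ->
  (A `|` U) (a *: u + v)) /\ ~ (A `|` U) x.
have [|A [[AP xA] Amax]] := @Zorn_bigcup V P.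
  move=> C CP Ctot; split; last first.
    by case=> // -[X CX Xx]; have [_] := CP X CX; apply; left.
  have UC X : C X -> X `|` U `<=` \bigcup_(Y in C) Y `|` U.
    by move=> CX y [Xy|Uy]; [left; exists X|right].
  move=> a u v [[X CX Xu]|Uu] [[Y CY Yv]|Uv]; last by right; apply: UP.
  - have [XY|YX] := Ctot X Y CX CY.
      by apply: (UC Y CY); apply: (CP Y CY).1; left => //; apply: XY.
    by apply: (UC X CX); apply: (CP X CX).1; left => //; apply: YX.
  - by apply: (UC X CX); apply: (CP X CX).1; [left|right].
  - by apply: (UC Y CY); apply: (CP Y CY).1; [right|left].
pose W := A `|` U; rewrite -/W in AP xA.
have W0 : W 0 by right.
have WZ a u : W u -> W (a *: u) by move=> Wu; rewrite -[_ *: _]addr0; apply: AP.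
have WB u v : W u -> W v -> W (u - v).
  by move=> Wu Wv; rewrite addrC -scaleN1r; apply: AP.
have decomp y : exists c, W (y - c *: x).
  apply: contrapT => /forallNP yx.
  (* [B] is the span of [y] and [W]; without a suitable [c] it would strictly contain [A] and still
     miss [x]. *)
  pose B := [set z | exists c w, W w /\ z = c *: y + w].
  have WB' : W `<=` B by move=> w Ww; exists 0, w; rewrite scale0r add0r.
  have BU : B `|` U = B.
    by apply/seteqP; split=> z; [case=> // Uz; apply: WB'; right|left].
  apply: (Amax B); last rewrite /P BU; last split.
  - rewrite properEneq; split; last by move=> z Az; apply: WB'; left.
    apply/eqP => AB; apply: (yx 0); rewrite scale0r subr0; left; rewrite AB.
    by exists 1, 0; rewrite scale1r addr0.
  - move=> a _ _ [c [w [Ww ->]]] [d [z [Wz ->]]].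
    exists (a * c + d), (a *: w + z); split; first exact: AP.
    by rewrite scalerDr scalerA scalerDl addrACA.
  - move=> [c [w [Ww xE]]].
    have [c0|c0] := eqVneq c 0.
      by apply: xA; rewrite xE c0 scale0r add0r.
    apply: (yx c^-1); rewrite xE scalerDr scalerA mulVf // scale1r opprD.
    by rewrite addNKr -scaleNr; apply: WZ.
pose f y := projT1 (cid (decomp y)).
have fP y : W (y - f y *: x) by rewrite /f; case: cid.
have fE c y : W (y - c *: x) -> f y = c.
  move=> Wy; apply/eqP; rewrite -subr_eq0; apply/eqP; apply: contrapT => /eqP d0.
  apply: xA; have := WZ (f y - c)^-1 _ (WB _ _ Wy (fP y)).
  rewrite opprB [_ - c *: x + _]addrC addrA addrNK -scalerBl.
  by rewrite scalerA mulVf // scale1r.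
have f_lin : scalar f.
  move=> a u v; apply: fE.
  rewrite scalerDl -scalerA opprD addrACA -scalerBr.
  exact: AP.
pose fL := GRing.isLinear.Build F V F *%R f f_lin.
pose fs : {scalar V} := HB.pack f fL.
exists fs; split; first by apply: fE; rewrite scale1r subrr.
by move=> u Uu; apply: fE; rewrite scale0r subr0; right.
Qed.

End Separation.

(** * Antisymmetry and contraction in the exterior square *)

Section Wedge.
Context {F : comNzRingType} {V : lmodType F}.

Lemma linear_wedgel (v : V) : linear (fun u => wedge u v).
Proof. by move=> a u w; rewrite wedgePl. Qed.

Lemma linear_wedger (v : V) : linear (wedge v).
Proof. by move=> a u w; rewrite wedgePr. Qed.

HB.instance Definition _ := bilinear_isBilinear.Build F V V (ext2 V) *:%R *:%R
  (@wedge F V) (linear_wedgel, linear_wedger).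

Lemma wedgeC (u v : V) : wedge u v = - wedge v u.
Proof.
apply/eqP; rewrite -addr_eq0; have := wedgevv (u + v).
by rewrite linearDl !linearDr /= !wedgevv addr0 add0r => ->.
Qed.

Lemma alternating_sum0 (W : lmodType F) (f : V -> V -> W) n (u v : 'I_n -> V) :
  alternating f -> \sum_i wedge (u i) (v i) = 0 -> \sum_i f (u i) (v i) = 0.
Proof.
move=> fA uv0; pose g : {linear ext2 V -> W} :=
  HB.pack (ext2_lift f) (GRing.isLinear.Build F _ _ _ _ (ext2_lift_is_linear fA)).
have := congr1 g uv0; rewrite linear0 linear_sum /=.
by under eq_bigr do rewrite ext2_lift_wedge //.
Qed.

(** The map sending [x] and [y] to [f x *: y - f y *: x] is alternating, so it respects vanishing
    sums of wedges. *)
Lemma wedge_contraction (f : {scalar V}) n (u v : 'I_n -> V) :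
  \sum_i wedge (u i) (v i) = 0 ->
  \sum_i f (u i) *: v i = \sum_i f (v i) *: u i.
Proof.
move=> uv0; apply/eqP; rewrite -subr_eq0 -sumrB; apply/eqP.
apply: (@alternating_sum0 V (fun x y => f x *: y - f y *: x)) uv0.
split=> [w a x y|w a x y|x]; last exact: subrr.
  rewrite linearP /= scalerDl -scalerA scalerDr scalerBr opprD !scalerA.
  by rewrite [f w * a]mulrC addrACA.
rewrite linearP /= scalerDl -scalerA scalerDr scalerBr opprD !scalerA.
by rewrite [f w * a]mulrC addrACA.
Qed.

End Wedge.

(** Swapping the indices shows that the sum is its own opposite, and 2 is invertible in Q. *)
Lemma sym_wedge_sum (V : lmodType rat) n (c : 'I_n -> 'I_n -> rat) (v : 'I_n -> V) :
  (forall i j, c i j = c j i) -> \sum_i \sum_j c i j *: wedge (v i) (v j) = 0.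
Proof.
move=> cC; set S := \sum_i _.
have SN : S = - S.
  rewrite {1}/S exchange_big -sumrN; apply: eq_bigr => i _.
  rewrite -sumrN; apply: eq_bigr => j _.
  by rewrite [wedge (v j) _]wedgeC scalerN cC.
have : 2%:R *: S = 0 by rewrite scaler_nat mulr2n {1}SN addNr.
by move/eqP; rewrite scaler_eq0 pnatr_eq0 => /eqP.
Qed.

(** * The trace form and symmetric tensors over K *)

Section TraceForm.
Context {K : fieldExtType rat}.
Local Notation tr := (@field_trace K).

Lemma field_traceE (x : K) :
  tr x = \sum_i coord (vbasis {:K}) i (x * (vbasis {:K})`_i).
Proof.
apply: eq_bigr => i _; rewrite !mxE /= /passmx.vecof.
rewrite (bigD1 i) //= mxE !eqxx scale1r big1 ?addr0 => [|j ji].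
  by rewrite lfunE /= mulrC.
by rewrite mxE eqxx (negPf ji) scale0r.
Qed.

Lemma field_trace_is_scalar : scalar tr.
Proof.
move=> a x y; rewrite !field_traceE mulr_sumr -big_split; apply: eq_bigr => i _.
by rewrite mulrDl -scalerAl linearP.
Qed.

HB.instance Definition _ :=
  GRing.isLinear.Build rat K rat *%R tr field_trace_is_scalar.

(** Expanding each [a j] in a basis recovers the product sum from contractions of the tensor by
    coordinate forms. *)
Lemma mul_coord_sum n (a b : 'I_n -> K) :
  \sum_j a j * b j =
  \sum_(i < \dim {:K}) (vbasis {:K})`_i * \sum_j coord (vbasis {:K}) i (a j) *: b j.
Proof.
under [RHS]eq_bigr => i _ do rewrite mulr_sumr.
rewrite exchange_big; apply: eq_bigr => j _.
rewrite {1}(coord_vbasis (memvf (a j))) mulr_suml.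
by apply: eq_bigr => i _; rewrite -scalerAl scalerAr.
Qed.

Section SymmetricTensor.
Context {n : nat}.
Variables a b : 'I_n -> K.

(* Says that x (a_1 (x) b_1 + ... + a_n (x) b_n), with x acting on the left
   factor, is a symmetric tensor for every x in K. *)
Hypothesis ab_sym : forall (f : {scalar K}) (x : K),
  \sum_j f (x * a j) *: b j = \sum_j f (b j) *: (x * a j).

(** Symmetry at [1] and at [y] moves a factor [y] out of any contraction. The trace is the sum of
    the coordinate forms precomposed with multiplication by the basis vectors, so contracting with
    it yields the product sum. *)
Lemma sym_trace_suml x : \sum_j tr (x * a j) *: b j = x * \sum_j a j * b j.
Proof.
pose A (f : {scalar K}) := \sum_j f (a j) *: b j.
have AE (f : {scalar K}) y : \sum_j f (y * a j) *: b j = y * A f.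
  have := ab_sym f 1; under eq_bigr do rewrite mul1r; rewrite /A => ->.
  rewrite ab_sym mulr_sumr; apply: eq_bigr => j _.
  by rewrite mul1r scalerAr.
rewrite AE /A; congr (x * _); rewrite mul_coord_sum.
under [RHS]eq_bigr => i _ do rewrite -(AE (coord (vbasis {:K}) i)).
rewrite exchange_big; apply: eq_bigr => j _.
rewrite /= field_traceE scaler_suml.
by apply: eq_bigr => i _; rewrite mulrC.
Qed.

Lemma sym_trace_sumr x : \sum_j tr (x * b j) *: a j = x * \sum_j a j * b j.
Proof.
pose f : {scalar K} := GRing.Linear.clone _ _ _ _ (tr \o amull x) _.
have fE y : f y = tr (x * y) by rewrite /= lfunE.
rewrite -sym_trace_suml; have := ab_sym f 1.
under eq_bigr do rewrite mul1r fE.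
by under [X in _ = X -> _]eq_bigr do rewrite mul1r fE.
Qed.

End SymmetricTensor.

(** * Expansions in dual bases *)

Section DualBases.
Context {n : nat} {alpha beta : n.-tuple K}.
Local Notation a j := (tnth alpha j).
Local Notation b j := (tnth beta j).

(** Pairing the expansion of [x] in [beta] with [a j] isolates its coordinate of index [j]. *)
Lemma dual_trace_sumr : dual_bases alpha beta ->
  forall x, x = \sum_j tr (x * a j) *: b j.
Proof.
move=> [_ bB ab] x; have xE := coord_basis bB (memvf x).
rewrite {1}xE; apply: eq_bigr => j _; rewrite -tnth_nth; congr (_ *: _).
rewrite {2}xE mulr_suml linear_sum (bigD1 j) //= big1 ?addr0 => [|i ij].
  by rewrite -tnth_nth -scalerAl linearZ /= [b _ * _]mulrC ab eqxx mulr1.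
by rewrite -tnth_nth -scalerAl linearZ /= [b _ * _]mulrC ab
  eq_sym (negPf ij) mulr0.
Qed.

Lemma dual_bases_sum : dual_bases alpha beta ->
  (forall x, \sum_j tr (x * a j) *: b j = x * \sum_j a j * b j) ->
  \sum_j a j * b j = 1.
Proof. by move=> ab /(_ 1); rewrite -dual_trace_sumr // mul1r. Qed.

(** The expansions make both families span, and their length is the dimension. Comparing coordinates
    of [b j] in the basis [beta] then yields duality. *)
Lemma trace_sum_dual_bases : \dim {:K} = n ->
  (forall x, x = \sum_j tr (x * a j) *: b j) ->
  (forall x, x = \sum_j tr (x * b j) *: a j) -> dual_bases alpha beta.
Proof.
move=> dimK xb xa.
have spanP (c : n.-tuple K) (f : 'I_n -> K -> rat) :
    (forall x, x = \sum_j f j x *: tnth c j) -> basis_of {:K} c.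
  move=> xc; rewrite basisEdim size_tuple dimK leqnn andbT.
  apply/subvP => x _; rewrite (xc x); apply: memv_suml => j _.
  by apply/memvZ/memv_span/mem_tnth.
have bB : basis_of {:K} beta := spanP _ (fun j x => tr (x * a j)) xb.
split=> // [|i j]; first exact: (spanP _ (fun j x => tr (x * b j))).
have xE : b j = \sum_k tr (b j * a k) *: beta`_k.
  by rewrite {1}(xb (b j)); apply: eq_bigr => k _; rewrite -tnth_nth.
have := congr1 (coord beta i) xE.
rewrite coord_sum_free ?(basis_free bB) // {1}(tnth_nth 0 beta).
by rewrite coord_free ?(basis_free bB) // mulrC eq_sym => ->.
Qed.

End DualBases.
End TraceForm.

(** * Real slopes that make a tensor over K symmetric *)

Section EmbeddedField.
Context {R : realType} {K : fieldExtType rat}.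
Variable iota : {rmorphism K -> R}.

(* R as a vector space over K, through iota. *)
Definition embline : Type := R.

HB.instance Definition _ := GRing.Zmodule.on embline.

Definition embline_scale (x : K) (r : embline) : embline := iota x * (r : R).

Fact embline_scaleA x y r :
  embline_scale x (embline_scale y r) = embline_scale (x * y) r.
Proof. by rewrite /embline_scale rmorphM mulrA. Qed.

Fact embline_scale1 : left_id 1 embline_scale.
Proof. by move=> r; rewrite /embline_scale rmorph1 mul1r. Qed.

Fact embline_scaleDr : right_distributive embline_scale +%R.
Proof. by move=> x r s; apply: mulrDr. Qed.

Fact embline_scaleDl r : {morph embline_scale^~ r : x y / x + y}.
Proof. by move=> x y; rewrite /embline_scale rmorphD; apply: mulrDl. Qed.

HB.instance Definition _ := GRing.Zmodule_isLmodule.Build K embline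
  embline_scaleA embline_scale1 embline_scaleDr embline_scaleDl.

Lemma rmorph_ratZ (q : rat) (x : K) : iota (q *: x) = ratr q * iota x.
Proof.
rewrite -mulr_algl rmorphM; congr (_ * _).
exact: (fmorph_eq_rat (GRing.RMorphism.clone _ _ (iota \o in_alg K) _)).
Qed.

Definition embedQ (x : K) : lineQ R := iota x.

Fact embedQ_is_linear : linear embedQ.
Proof. by move=> q x y; rewrite /embedQ rmorphD rmorph_ratZ. Qed.

HB.instance Definition _ := GRing.isLinear.Build rat K (lineQ R) *:%R
  embedQ embedQ_is_linear.

Fact embline_scalar_rat (f : {scalar K}) (phi : {scalar embline}) :
  scalar (fun r : lineQ R => f (phi r)).
Proof.
move=> q u v; rewrite -linearP; congr (f _).
have -> : q *: u + v = q%:A *: (u : embline) + v :> embline.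
  by congr (_ + _); rewrite -[RHS]/(iota _ * _) rmorph_ratZ rmorph1 mulr1.
by rewrite linearP /= mulr_algl.
Qed.

Section Tensor.
Context {n : nat}.
Variables a b : 'I_n -> K.

(** Up to sign and a common real scaling of the factors, this wedge sum is the SAF invariant in the
    direction of slope [s]. *)
Definition symmetric_slope (s : R) : Prop :=
  \sum_j wedge (s * iota (a j) : lineQ R) (iota (b j) : lineQ R) = 0.

(** Contraction by [f] after [phi]: the K-linearity of [phi] leaves only its values at [s] and [1],
    which can then be prescribed. *)
Lemma symmetric_slope_contraction (f : {scalar K}) (phi : {scalar embline}) s :
    symmetric_slope s ->
  iota (\sum_j f (a j * phi s) *: b j) =
  s * iota (\sum_j f (b j * phi 1) *: a j).
Proof.
pose fphi : {scalar lineQ R} := HB.pack (fun r : lineQ R => f (phi r))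
  (GRing.isLinear.Build rat (lineQ R) rat *%R _ (embline_scalar_rat f phi)).
move=> /(wedge_contraction fphi); rewrite /fphi /= => ab.
have phiE x r : phi (r * iota x) = x * phi r.
  have -> : r * iota x = x *: (r : embline) by rewrite mulrC.
  by rewrite linearZ.
rewrite !rmorph_sum /= mulr_sumr.
have := ab; under eq_bigr do rewrite phiE.
under [X in _ = X -> _]eq_bigr => j _ do rewrite -[iota (b j)]mul1r phiE.
move=> abE; under eq_bigr do rewrite rmorph_ratZ.
under [RHS]eq_bigr do rewrite rmorph_ratZ mulrCA.
exact: abE.
Qed.

(** For [s] outside K some [phi] vanishes on K and is 1 at [s]. Contraction then gives
    [\sum_j f (a j) *: b j = 0] for every [f], which kills the product sum. *)
Lemma symmetric_slope_range s :
  \sum_j a j * b j != 0 -> symmetric_slope s -> range iota s.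
Proof.
move=> ab0 abs; apply: contrapT => sK; move/eqP: ab0; apply.
pose U := range iota : set embline.
have [|x _ _ [y _ <-] [z _ <-]||phi [phi_s phiK]] :=
    @scalar_separation K embline U (s : embline).
- by exists 0; rewrite ?rmorph0.
- by exists (x * y + z); rewrite // rmorphD rmorphM.
- exact: sK.
have phi1 : phi 1 = 0 by apply: phiK; exists 1; rewrite ?rmorph1.
have ab0 (f : {scalar K}) : \sum_j f (a j) *: b j = 0.
  apply: (fmorph_inj iota); rewrite rmorph0.
  have := symmetric_slope_contraction f phi abs.
  rewrite phi_s phi1; under eq_bigr do rewrite mulr1.
  move=> ->; rewrite big1 ?rmorph0 ?mulr0 // => j _.
  by rewrite mulr0 linear0 scale0r.
by rewrite mul_coord_sum big1 // => i _; rewrite ab0 mulr0.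
Qed.

(** A [phi] with value 1 at 1 is a K-linear retraction of the reals onto K, so contraction with it
    gives an identity within K. *)
Lemma symmetric_slope_sym (f : {scalar K}) x : symmetric_slope (iota x) ->
  \sum_j f (x * a j) *: b j = \sum_j f (b j) *: (x * a j).
Proof.
move=> abx; have [||x1|phi [phi1 _]] :=
    @scalar_separation K embline [set 0] (1 : R).
- by [].
- by move=> c _ _ -> ->; rewrite scaler0 addr0.
- by move/eqP: x1; rewrite oner_eq0.
apply: (fmorph_inj iota).
have phix : phi (iota x) = x.
  pose e : embline := (1 : R).
  have -> : iota x = x *: e by rewrite -[RHS]/(iota x * 1) mulr1.
  by rewrite linearZ /= phi1 mulr1.
have := symmetric_slope_contraction f phi abx.
rewrite phix phi1 -rmorphM mulr_sumr.
under eq_bigr do rewrite mulrC; under [X in _ = iota X -> _]eq_bigr do rewrite mulr1.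
by move=> ->; congr (iota _); apply: eq_bigr => j _; rewrite scalerAr.
Qed.

End Tensor.

(** Expanding [x * tnth alpha j] in [beta] leaves wedges of [b i] and [b j] with coefficients
    symmetric in [i] and [j]. *)
Lemma dual_symmetric_slope n (alpha beta : n.-tuple K) x :
  dual_bases alpha beta ->
  symmetric_slope (tnth alpha) (tnth beta) (iota x).
Proof.
move=> ab; pose b j := embedQ (tnth beta j).
rewrite /symmetric_slope.
pose c i j := field_trace (x * tnth alpha i * tnth alpha j).
transitivity (\sum_j \sum_i c j i *: wedge (b i) (b j)).
  apply: eq_bigr => j _; rewrite -rmorphM -/(embedQ _) -/(b j).
  rewrite {1}(dual_trace_sumr ab (x * tnth alpha j)) linear_sum linear_sumlz.
  by apply: eq_bigr => i _; rewrite linearZ linearZl_LR.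
rewrite exchange_big /=; apply: (@sym_wedge_sum (lineQ R) n (fun i j => c j i)).
by move=> i j; rewrite /c mulrAC.
Qed.

End EmbeddedField.

(** * Periodic directions under linear maps *)

Section PeriodicDirections.
Context {R : realType}.
Implicit Types (J : ext2 (planeQ R)) (g : 'M[R]_2) (v w : 'cV[R]_2).

Lemma wedge_sum_scale n (u w : 'I_n -> R) (c : R) : c != 0 ->
  \sum_j wedge (c * u j : lineQ R) (c * w j : lineQ R) = 0 <->
  \sum_j wedge (u j : lineQ R) (w j : lineQ R) = 0.
Proof.
have imp (d : R) (x y : 'I_n -> R) :
    \sum_j wedge (x j : lineQ R) (y j : lineQ R) = 0 ->
    \sum_j wedge (d * x j : lineQ R) (d * y j : lineQ R) = 0.
  pose h : {linear lineQ R -> lineQ R} := ratlin ( *:%R d : R^o -> R^o).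
  move=> /(congr1 (ext2_map h)); rewrite linear0 linear_sum /=.
  by under eq_bigr do rewrite ext2_map_wedge.
move=> c0; split=> [/(imp c^-1)|]; last exact: imp.
by under eq_bigr do rewrite !mulKf //.
Qed.

Lemma vec2E0 (a b : R) : (vec2 a b : 'cV[R]_2) 0 0 = a.
Proof. by rewrite mxE eqxx. Qed.

Lemma vec2E1 (a b : R) : (vec2 a b : 'cV[R]_2) 1 0 = b.
Proof. by rewrite mxE. Qed.

Lemma cV2P (T : nzRingType) (v w : 'cV[T]_2) :
  v = w <-> v 0 0 = w 0 0 /\ v 1 0 = w 1 0.
Proof.
split=> [->//|[vw0 vw1]]; apply/matrixP=> i j; rewrite ord1.
have [->//|i0] := eqVneq i 0; suff -> : i = 1 by [].
by apply/val_inj; case: i i0 => -[|[|]].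
Qed.

Lemma cV2_neq0 v : v 0 0 != 0 \/ v 1 0 != 0 -> v != 0.
Proof.
by move=> v0; apply/eqP=> vE; case: v0; rewrite vE mxE eqxx.
Qed.

Lemma det_mx22 (T : comNzRingType) (M : 'M[T]_2) :
  \det M = M 0 0 * M 1 1 - M 0 1 * M 1 0.
Proof.
rewrite (expand_det_row _ 0) !big_ord_recl big_ord0 addr0 /cofactor !det_mx11.
rewrite !mxE /= /bump /= expr0 expr1 mul1r mulN1r mulrN.
by congr (_ * M _ _ - M _ _ * M _ _); apply/val_inj.
Qed.

Lemma linear_actionK g : g \in unitmx ->
  cancel (linear_action g) (linear_action (invmx g)).
Proof.
move=> gU; elim/(@ext2_span_ind rat (planeQ R)) => [|a x y J IH].
  by rewrite !linear0.
by rewrite !linearP /= !linear_action_wedge !mulKmx // IH.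
Qed.

Lemma periodic_direction_linear_action g J v : g \in unitmx ->
  periodic_direction (linear_action g J) v <->
  periodic_direction J (invmx g *m v).
Proof.
move=> gU; split=> [Jv|/(periodic_direction_action gU (oner_neq0 R))].
  have gU' : invmx g \in unitmx by rewrite unitmx_inv.
  have := periodic_direction_action gU' (oner_neq0 R) Jv.
  by rewrite linear_actionK // scale1r.
by rewrite mulKVmx // scale1r.
Qed.

(** * Area and periodic directions of a sum of axis-parallel wedges *)

Section BoxSum.
Context {K : fieldExtType rat} (iota : {rmorphism K -> R}) {n : nat}.
Variables a b : 'I_n -> K.

Let J : ext2 (planeQ R) :=
  \sum_j wedge (vec2 (iota (a j)) 0) (vec2 0 (iota (b j))).

Lemma area_sum_wedge : area J = iota (\sum_j a j * b j).
Proof.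
have detA : alternating (det2 : planeQ R -> planeQ R -> lineQ R).
  split=> [z c x y|z c x y|x] /=; last by rewrite det2E mulrC subrr.
    rewrite !det2E !mxE /GRing.scale /= /ratspace_scale.
    by rewrite -[ratr c *: _]/(ratr c * _); move: (ratr c) => d; ring.
  rewrite !det2E !mxE /GRing.scale /= /ratspace_scale.
  by rewrite -[ratr c *: _]/(ratr c * _); move: (ratr c) => d; ring.
pose f : {linear ext2 (planeQ R) -> lineQ R} :=
  HB.pack (@area R) (GRing.isLinear.Build rat _ _ _ _ (ext2_lift_is_linear detA)).
rewrite -[area J]/(f J) linear_sum /= rmorph_sum.
by apply: eq_bigr => j _; rewrite area_vec2 rmorphM.
Qed.

(** With [N] the length of [v], the projection multiplies horizontal entries by [- v 1 0 / N] and
    vertical ones by [v 0 0 / N]. A vertical [v] makes each wedge vanish; otherwise [v 0 0 / N]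
    factors out of both sides. *)
Lemma periodic_direction_sum_wedge v : periodic_direction J v <->
  v != 0 /\ (v 0 0 = 0 \/ symmetric_slope iota a b (v 1 0 / v 0 0)).
Proof.
suff SAFE : v != 0 -> (SAF v J = 0) <->
    (v 0 0 = 0 \/ symmetric_slope iota a b (v 1 0 / v 0 0)).
  by split=> -[v0 Jv]; split=> //; apply/SAFE.
move=> v0; pose N := Num.sqrt (v 0 0 ^+ 2 + v 1 0 ^+ 2).
have N0 : N != 0 := norm2_neq0 v0.
have JE : SAF v J = \sum_j wedge (- (v 1 0 * iota (a j)) / N : lineQ R)
    (v 0 0 * iota (b j) / N : lineQ R).
  rewrite linear_sum /=; apply: eq_bigr => j _; rewrite SAF_wedge.
  by rewrite /orthproj !vec2E0 !vec2E1 !mulr0 sub0r subr0.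
have [v00|v00] := eqVneq (v 0 0) 0.
  split=> [_|_]; first by left.
  by rewrite JE big1 // => j _; rewrite v00 !mul0r linear0r.
have -> : (SAF v J = 0) <-> symmetric_slope iota a b (v 1 0 / v 0 0).
  rewrite JE /symmetric_slope -(wedge_sum_scale _ _ (mulf_neq0 v00 (invr_neq0 N0))).
  have -> : \sum_j wedge (- (v 1 0 * iota (a j)) / N : lineQ R)
      (v 0 0 * iota (b j) / N : lineQ R) =
    - \sum_j wedge (v 0 0 / N * (v 1 0 / v 0 0 * iota (a j)) : lineQ R)
      (v 0 0 / N * iota (b j) : lineQ R).
    rewrite -sumrN; apply: eq_bigr => j _; rewrite -linearNl.
    congr wedge; first by field; rewrite v00.
    by rewrite mulrAC.
  by split=> [/eqP|->]; rewrite ?oppr0 // oppr_eq0 => /eqP.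
by split=> [|[/eqP|]] //; [right|rewrite (negPf v00)].
Qed.

End BoxSum.

(** * Directions defined over K *)

Section FieldDirections.
Context {K : fieldExtType rat} (iota : {rmorphism K -> R}).

(** Trades slopes in K or infinite for a form on which matrices over K visibly act. *)
Lemma field_direction v :
  (v 0 0 = 0 \/ range iota (v 1 0 / v 0 0)) <->
  exists (t : R) (w : 'cV[K]_2), v = t *: map_mx iota w.
Proof.
split=> [[v00|[x _ xv]]|[t [w vE]]].
- exists (v 1 0), (\col_(i < 2) if i == 0 then 0 else 1).
  by apply/cV2P; rewrite !mxE /= rmorph0 rmorph1 mulr0 mulr1.
- have [v00|v00] := eqVneq (v 0 0) 0.
    exists (v 1 0), (\col_(i < 2) if i == 0 then 0 else 1).
    by apply/cV2P; rewrite !mxE /= rmorph0 rmorph1 mulr0 mulr1.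
  exists (v 0 0), (\col_(i < 2) if i == 0 then 1 else x).
  by apply/cV2P; rewrite !mxE /= rmorph1 xv mulr1 mulrC divfK.
have [v00|v00] := eqVneq (v 0 0) 0; [by left|right].
exists (w 1 0 / w 0 0) => //; move: v00; rewrite vE !mxE mulf_eq0 negb_or.
by move=> /andP[t0 w0]; rewrite fmorph_div -mulf_div divff // mul1r.
Qed.

(* A linear map taking three pairwise distinct K-rational directions to
   K-rational directions is, up to a real factor, defined over K. *)
Lemma field_directions_matrix (h : 'M[R]_2) : h \in unitmx ->
    (forall v, v = vec2 1 0 \/ v = vec2 0 1 \/ v = vec2 1 1 ->
       exists (t : R) (w : 'cV[K]_2), h *m v = t *: map_mx iota w) ->
  exists (t : R) (H : 'M[K]_2),
    [/\ t != 0, H \in unitmx & h = t *: map_mx iota H].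
Proof.
move=> hU hK.
have [t1 [w1 e1]] := hK (vec2 1 0) (or_introl erefl).
have [t2 [w2 e2]] := hK (vec2 0 1) (or_intror (or_introl erefl)).
have [t3 [w3 e3]] := hK (vec2 1 1) (or_intror (or_intror erefl)).
have hE i (x y : R) : (h *m (vec2 x y : 'cV[R]_2)) i 0 = h i 0 * x + h i 1 * y.
  rewrite mxE !big_ord_recl big_ord0 addr0; congr (_ * _ + h i _ * _).
  - by rewrite mxE.
  - exact/val_inj.
  - by rewrite mxE.
have h0 i : h i 0 = t1 * iota (w1 i 0).
  by move/matrixP/(_ i 0): e1; rewrite hE mulr1 mulr0 addr0 !mxE.
have h1 i : h i 1 = t2 * iota (w2 i 0).
  by move/matrixP/(_ i 0): e2; rewrite hE mulr1 mulr0 add0r !mxE.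
have h3 i : t1 * iota (w1 i 0) + t2 * iota (w2 i 0) = t3 * iota (w3 i 0).
  by move/matrixP/(_ i 0): e3; rewrite hE !mulr1 h0 h1 !mxE.
pose d := w1 0 0 * w2 1 0 - w1 1 0 * w2 0 0.
have d0 : t1 * t2 * iota d != 0.
  suff <- : \det h = t1 * t2 * iota d by rewrite -unitfE -unitmxE.
  by rewrite det_mx22 !h0 !h1 /d rmorphB !rmorphM /=; ring.
move: d0; rewrite !mulf_eq0 !negb_or => /andP[/andP[t10 t20] d0].
(* Cramer's rule: [x] and [y] are the coordinates of [w3] on [w1] and [w2], so [h3] expresses [t1]
   and [t2] through [t3]. *)
pose x := (w3 0 0 * w2 1 0 - w3 1 0 * w2 0 0) / d.
pose y := (w1 0 0 * w3 1 0 - w1 1 0 * w3 0 0) / d.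
have t1E : t1 = t3 * iota x.
  rewrite /x fmorph_div mulrA; apply: (canRL (mulfK d0)).
  transitivity (t3 * iota (w3 0 0) * iota (w2 1 0)
    - t3 * iota (w3 1 0) * iota (w2 0 0)).
    by rewrite -!h3 /d rmorphB !rmorphM /=; ring.
  by rewrite rmorphB !rmorphM /=; ring.
have t2E : t2 = t3 * iota y.
  rewrite /y fmorph_div mulrA; apply: (canRL (mulfK d0)).
  transitivity (iota (w1 0 0) * (t3 * iota (w3 1 0))
    - iota (w1 1 0) * (t3 * iota (w3 0 0))).
    by rewrite -!h3 /d rmorphB !rmorphM /=; ring.
  by rewrite rmorphB !rmorphM /=; ring.
pose H : 'M[K]_2 := \matrix_(i, j) if j == 0 then x * w1 i 0 else y * w2 i 0.
have hH : h = t3 *: map_mx iota H.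
  apply/matrixP=> i j; rewrite !mxE.
  have [->|j0] := eqVneq j 0; first by rewrite h0 t1E rmorphM mulrA.
  have -> : j = 1 by apply/val_inj; case: j j0 => -[|[|]].
  by rewrite h1 t2E rmorphM mulrA.
have t30 : t3 != 0 by apply: contraNneq t10 => t30; rewrite t1E t30 mul0r.
exists t3, H; split=> //; rewrite -(map_unitmx iota).
by move: hU; rewrite hH unitmxZ // unitfE.
Qed.

End FieldDirections.

(** [invmx g] takes the slopes 0, 1 and oo to periodic directions of [J], so up to a factor it is a
    matrix over K. It and its inverse then preserve the K-rational directions. *)
Lemma periodic_slopes_field_directions {K : fieldExtType rat}
    (iota : {rmorphism K -> R}) J :
    (forall v, v != 0 -> periodic_direction J v <->
       exists (t : R) (w : 'cV[K]_2), v = t *: map_mx iota w) ->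
  forall g, g \in unitmx -> normalized (linear_action g J) ->
  periodic_slopes (linear_action g J) = range iota.
Proof.
move=> JK g gU [g10 g11 g01].
have hU : invmx g \in unitmx by rewrite unitmx_inv.
have h0 v : v != 0 -> invmx g *m v != 0.
  by apply: contra_neq => gv; rewrite -(mulKVmx gU v) gv mulmx0.
have [v|t [H [t0 HU hE]]] := @field_directions_matrix K iota _ hU.
  move=> vE; have : periodic_direction (linear_action g J) v.
    by case: vE => [->|[->|->]].
  by case=> v0 gv; apply/JK; [exact: h0|apply/periodic_direction_linear_action].
have slopeE s : range iota s <->
    exists (t : R) (w : 'cV[K]_2), (vec2 1 s : 'cV[R]_2) = t *: map_mx iota w.
  rewrite -field_direction vec2E0 vec2E1 divr1.
  by split=> [|[/eqP|]] //; [right|rewrite oner_eq0].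
have e0 s : (vec2 1 s : 'cV[R]_2) != 0.
  by apply: cV2_neq0; left; rewrite vec2E0 oner_neq0.
apply/seteqP; split=> s.
  move=> /(periodic_direction_linear_action _ _ gU) /JK [|r [w hs]].
    exact: h0.
  apply/slopeE; exists (r / t), (invmx H *m w).
  rewrite -(mulKVmx gU (vec2 1 s)) hs.
  apply: (can_inj (mulKmx hU)); rewrite mulKmx // {1}hE map_mxM.
  rewrite -scalemxAl -scalemxAr scalerA mulrC divfK // map_invmx mulKVmx //.
  by rewrite map_unitmx.
move=> /slopeE [r [w vE]]; apply/periodic_direction_linear_action => //.
apply/JK; first exact: h0.
exists (t * r), (H *m w).
by rewrite vE {1}hE map_mxM -scalemxAl -scalemxAr scalerA.
Qed.

(** Of three pairwise nonparallel directions at most two lie on the axes. *)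
Lemma third_direction J : algebraically_periodic J ->
  exists v, [/\ periodic_direction J v, v 0 0 != 0 & v 1 0 != 0].
Proof.
move=> [v1 [v2 [v3 [[J1 J2 J3] []]]]]; rewrite !det2E.
have [v10|v10] := eqVneq (v1 0 0) 0; last have [v11|v11] := eqVneq (v1 1 0) 0.
- rewrite v10 !mul0r !sub0r !oppr_eq0 !mulf_eq0 !negb_or.
  move=> /andP[_ v20] /andP[_ v30].
  have [v21|v21] := eqVneq (v2 1 0) 0; last by exists v2.
  by rewrite v21 mul0r subr0 mulf_eq0 negb_or => /andP[_ v31]; exists v3.
- rewrite v11 !mul0r !subr0 !mulf_eq0 !negb_or.
  move=> /andP[_ v21] /andP[_ v31].
  have [v20|v20] := eqVneq (v2 0 0) 0; last by exists v2.
  by rewrite v20 mul0r sub0r oppr_eq0 mulf_eq0 negb_or => /andP[_ v30]; exists v3.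
- by exists v1.
Qed.

(** * Periodic direction field against symmetric slopes *)

Section BoxSumField.
Context {K : fieldExtType rat} (iota : {rmorphism K -> R}) {n : nat}.
Variables a b : 'I_n -> K.

Let J : ext2 (planeQ R) :=
  \sum_j wedge (vec2 (iota (a j)) 0) (vec2 0 (iota (b j))).

Lemma symmetric_slope0 : symmetric_slope iota a b 0.
Proof. by rewrite /symmetric_slope big1 // => j _; rewrite mul0r linear0l. Qed.

(** The nonzero product sum confines the finite periodic slopes to K, and the symmetry hypothesis
    fills K: the periodic directions are the K-rational ones. *)
Lemma symmetric_slopes_periodic : J != 0 -> \sum_j a j * b j != 0 ->
    (forall x, symmetric_slope iota a b (iota x)) ->
  algebraically_periodic J /\ is_periodic_direction_field J (range iota).
Proof.
move=> J0 ab0 abK.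
have JK v : v != 0 -> periodic_direction J v <->
    exists (t : R) (w : 'cV[K]_2), v = t *: map_mx iota w.
  move=> v0; rewrite -field_direction periodic_direction_sum_wedge.
  split=> [[_ [|/(symmetric_slope_range ab0)]]|vK]; [by left|by right|].
  by split=> //; case: vK => [|[x _ <-]]; [left|right].
have e10 : (vec2 1 0 : 'cV[R]_2) != 0.
  by apply: cV2_neq0; left; rewrite vec2E0 oner_neq0.
have e01 : (vec2 0 1 : 'cV[R]_2) != 0.
  by apply: cV2_neq0; right; rewrite vec2E1 oner_neq0.
have e11 : (vec2 1 1 : 'cV[R]_2) != 0.
  by apply: cV2_neq0; left; rewrite vec2E0 oner_neq0.
suff Jper : algebraically_periodic J.
  by split=> //; split=> //; exact: periodic_slopes_field_directions.
exists (vec2 1 0), (vec2 0 1), (vec2 1 1); split; split.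
- by apply/JK/field_direction; rewrite // vec2E1; right; exists 0;
    rewrite ?rmorph0 ?mul0r.
- by apply/JK/field_direction; rewrite // vec2E0; left.
- by apply/JK/field_direction; rewrite // vec2E0 vec2E1; right; exists 1;
    rewrite ?rmorph1 ?divr1.
- by rewrite det2E !vec2E0 !vec2E1 mulr1 mul0r subr0 oner_neq0.
- by rewrite det2E !vec2E0 !vec2E1 mulr1 mul0r subr0 oner_neq0.
- by rewrite det2E !vec2E0 !vec2E1 !mulr1 sub0r oppr_eq0 oner_neq0.
Qed.

(* When s is the slope of a third periodic direction, diag(1, 1/s) normalizes
   J, so that the periodic slopes of J are s K; the area then forces s in K. *)
Lemma periodic_direction_field_symmetric_slopes :
    algebraically_periodic J -> is_periodic_direction_field J (range iota) ->
    \sum_j a j * b j != 0 ->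
  forall x, symmetric_slope iota a b (iota x).
Proof.
move=> Jper [_ _ JK] ab0.
have [v [/periodic_direction_sum_wedge [_ [/eqP|]]]] := third_direction Jper.
  by move=> v0 /negP.
set s := v 1 0 / v 0 0 => abs v0 v1.
have s0 : s != 0 by rewrite mulf_neq0 ?invr_neq0.
(* The normalizing map is [invmx h]; [h] itself sends slope [x] to slope [s * x]. *)
pose h : 'M[R]_2 :=
  \matrix_(i, j) if i == j then if i == 0 then 1 else s else 0.
have hU : h \in unitmx.
  by rewrite unitmxE det_mx22 !mxE /= mul1r mulr0 subr0 unitfE.
have hE (x y : R) : h *m (vec2 x y : 'cV[R]_2) = vec2 x (s * y).
  apply/cV2P; rewrite !mxE !big_ord_recl !big_ord0 !mxE /= !mul0r !mul1r.
  by rewrite !addr0 add0r.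
have gU : invmx h \in unitmx by rewrite unitmx_inv.
have slopeP x : periodic_direction (linear_action (invmx h) J) (vec2 1 x) <->
    symmetric_slope iota a b (s * x).
  rewrite periodic_direction_linear_action // invmxK hE.
  rewrite periodic_direction_sum_wedge vec2E0 vec2E1 divr1.
  split=> [[_ [/eqP|]]|] //; first by rewrite oner_eq0.
  by split; [apply: cV2_neq0; left; rewrite vec2E0 oner_neq0|right].
have slopes : periodic_slopes (linear_action (invmx h) J) = range iota.
  apply: JK => //; split.
  - by apply/slopeP; rewrite mulr0; exact: symmetric_slope0.
  - by apply/slopeP; rewrite mulr1.
  - rewrite periodic_direction_linear_action // invmxK hE mulr1.
    rewrite periodic_direction_sum_wedge vec2E0; split; last by left.
    by apply: cV2_neq0; right; rewrite vec2E1.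
have [y _ ys] := symmetric_slope_range ab0 abs.
have y0 : y != 0 by rewrite -(fmorph_eq0 iota) ys.
(* As [s] is a nonzero element of K, every element of K is [s] times another one. *)
move=> x; have -> : iota x = s * iota (x / y).
  by rewrite -ys -rmorphM mulrC divfK.
apply/slopeP; have : range iota (iota (x / y)) by exists (x / y).
by rewrite -slopes.
Qed.

End BoxSumField.
End PeriodicDirections.

Theorem theorem1p15 (R : realType) (n : nat) (K : fieldExtType rat)
    (iota : {rmorphism K -> R}) (dimK : \dim {:K} = n) :
  (forall (alpha beta : n.-tuple K) (J : ext2 (planeQ R)),
     dual_bases alpha beta ->
     J = \sum_(j < n) wedge (vec2 (iota (tnth alpha j)) 0)
                            (vec2 0 (iota (tnth beta j))) ->
     algebraically_periodic J /\ is_periodic_direction_field J (range iota))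
  /\
  (forall (alpha beta : n.-tuple K) (J : ext2 (planeQ R)),
     J = \sum_(j < n) wedge (vec2 (iota (tnth alpha j)) 0)
                            (vec2 0 (iota (tnth beta j))) ->
     algebraically_periodic J ->
     is_periodic_direction_field J (range iota) ->
     area J = 1 ->
     dual_bases alpha beta).
Proof.
split=> [alpha beta J ab ->|alpha beta J -> Jper JK].
  have abK x := dual_symmetric_slope iota x ab.
  have ab1 : \sum_j tnth alpha j * tnth beta j = 1.
    apply: dual_bases_sum ab _; apply: sym_trace_suml => f x.
    exact: symmetric_slope_sym (abK x).
  apply: symmetric_slopes_periodic abK; last by rewrite ab1 oner_neq0.
  (* [J] is nonzero because its area is 1; the area of 0 is computed below as that of an empty
     sum. *)
  apply/eqP => J0; have := area_sum_wedge iota (tnth alpha) (tnth beta).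
  rewrite J0 ab1 rmorph1 => /eqP; rewrite eq_sym.
  have -> : area (0 : ext2 (planeQ R)) = 0.
    have := area_sum_wedge iota (fun _ : 'I_0 => 0) (fun=> 0).
    by rewrite !big_ord0 rmorph0.
  by rewrite oner_eq0.
rewrite area_sum_wedge -[RHS](rmorph1 iota) => /fmorph_inj ab1.
have abK := periodic_direction_field_symmetric_slopes Jper JK.
rewrite ab1 oner_neq0 in abK.
(* Symmetry for all of K and product sum 1 turn the trace sums into the two expansions of [x] that
   force duality. *)
have sym (f : {scalar K}) x := symmetric_slope_sym f (abK isT x).
apply: trace_sum_dual_bases => // x.
  by rewrite (sym_trace_suml sym) ab1 mulr1.
by rewrite (sym_trace_sumr sym) ab1 mulr1.
Qed.
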